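(* Let $q$ be an odd prime power and $n$ a positive integer. Let $G$ be the sum-product digraph over $M_n(\mathbb{F}_q)$: its vertex set is $M_n(\mathbb{F}_q)\times M_n(\mathbb{F}_q)$, and there is a directed edge from $(A,C)$ to $(B,D)$ if and only if $A\cdot B = C+D$. Then there is a constant $c>0$ (independent of $q$) such that $G$ is a $(q^{2n^2},\,q^{n^2},\,c\,q^{n^2-1/2})$-digraph.
   Context: $M_n(\mathbb{F}_q)$ is the ring of $n\times n$ matrices over $\mathbb{F}_q$. For a digraph $G$ in which every vertex has in-degree and out-degree $d$, with adjacency matrix $A_G$ (entry $1$ if there is a directed edge from $i$ to $j$, else $0$) having (possibly complex) eigenvalues $\lambda_1=d,\lambda_2,\dots$, set $\lambda(G)=\max\{|\lambda_i| : |\lambda_i|\neq d\}$. A digraph is an $(N,d,\lambda)$-digraph if it has $N$ vertices, every vertex has in-degree and out-degree both equal to $d$, and $\lambda(G)\le\lambda$. *)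

(* Defs.v *)
From HB Require Import structures.
From mathcomp Require Import all_boot all_order all_algebra.
From mathcomp Require Import complex.
From mathcomp Require Import reals exp.

Set Implicit Arguments.
Unset Strict Implicit.
Unset Printing Implicit Defensive.

Import Order.TTheory GRing.Theory Num.Theory.
Import ComplexField.Normc.

Local Open Scope ring_scope.

Definition adjacency_mx (R : realType) (V : finType) (e : rel V) :
    'M[R[i]]_#|V| :=
  \matrix_(i, j) (e (enum_val i) (enum_val j))%:R.

(* The complex roots of the characteristic polynomial, listed with their
   algebraic multiplicities. *)
Definition eigenvalues (R : realType) (N : nat) (A : 'M[R[i]]_N) : seq R[i] :=
  sval (closed_field_poly_normal (char_poly A)).

(* All moduli are nonnegative, so the default value 0 only matters when every
   eigenvalue has modulus d; the maximum over the empty set is then 0. *)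
Definition digraph_lambda (R : realType) (V : finType) (e : rel V) (d : nat) :
    R :=
  \big[Num.max/0]_(z <- eigenvalues (adjacency_mx R e) | normc z != d%:R)
     normc z.

Definition ndl_digraph (R : realType) (V : finType) (e : rel V)
    (N d : nat) (l : R) : Prop :=
  [/\ #|V| = N,
      forall x : V, #|[set y | e x y]| = d,
      forall y : V, #|[set x | e x y]| = d
    & digraph_lambda R e d <= l].

Definition sum_product_edge (F : finFieldType) (n : nat) :
    rel ('M[F]_n * 'M[F]_n) :=
  fun u v => u.1 *m v.1 == u.2 + v.2.

(* Main.v *)
(* Let M be the adjacency matrix. An eigenvector v for z != d is orthogonal to
   the all-ones vector, so |z|^2 |v|^2 = v (M M^T - J) v^*, and since M M^T - J
   is symmetric, |z|^2 is at most its largest absolute row sum. The entry of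
   M M^T at ((A, C), (A', C')) counts the B with (A - A') B = C - C'; it is 1
   when A - A' is invertible, so only the at most n q^(n^2 - 1) singular
   differences contribute, each at most 2 q^(n^2) to a row sum. *)
Require Import Defs.
From mathcomp Require Import all_boot all_order all_algebra.
From mathcomp Require Import fingroup.
From mathcomp Require Import complex.
From mathcomp Require Import reals exp.
From mathcomp Require Import zify.

Import Order.TTheory GRing.Theory Num.Theory.
Local Open Scope ring_scope.

Set Implicit Arguments.
Unset Strict Implicit.
Unset Printing Implicit Defensive.

(** * Codegrees and the spectral bound *)

Definition codegree (V : finType) (e : rel V) (x y : V) : nat :=
  #|[set t | e x t && e y t]|.

Lemma codegreeC (V : finType) (e : rel V) (x y : V) :
  codegree e x y = codegree e y x.
Proof. by apply: eq_card => t; rewrite !inE andbC. Qed.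

Lemma codegree_sum (C : numClosedFieldType) (V : finType) (e : rel V)
    (x y : V) :
  (codegree e x y)%:R = \sum_t (e x t)%:R * (e y t)%:R :> C.
Proof.
rewrite /codegree -sum1_card natr_sum big_mkcond /=; apply: eq_bigr => t _.
by rewrite inE; case: (e x t); case: (e y t); rewrite ?mulr1 ?mulr0.
Qed.

Section Spectral.
Variables (C : numClosedFieldType) (V : finType) (e : rel V).
Variables (v : V -> C) (z : C).
Hypothesis eigen_v : forall y, \sum_x v x * (e x y)%:R = z * v y.

(** Summing the eigenvector equation over [y] counts each [v x] once per out-neighbour, so [z] and
    [d] scale the total of [v] equally. *)
Lemma eigenvector_sum0 (d : nat) :
  (forall x, #|[set y | e x y]| = d) -> z != d%:R -> \sum_x v x = 0.
Proof.
move=> deg_d zNd.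
have: z * (\sum_x v x) = d%:R * \sum_x v x.
  rewrite mulr_sumr -(eq_bigr _ (fun y _ => eigen_v y)) exchange_big /=.
  rewrite mulr_sumr; apply: eq_bigr => x _; rewrite -mulr_sumr mulrC.
  congr (_ * _); rewrite -(deg_d x) -sum1_card natr_sum [RHS]big_mkcond /=.
  by apply: eq_bigr => y _; rewrite inE; case: (e x y).
by move/eqP; rewrite -subr_eq0 -mulrBl mulf_eq0 subr_eq0 (negPf zNd) => /eqP.
Qed.

(** Both sides are the squared norm of [v] times the adjacency matrix; on the right each square is
    expanded and the sum over the common out-neighbour [t] is done first. *)
Lemma eigenvector_codegree :
  `|z| ^+ 2 * (\sum_x `|v x| ^+ 2) =
  \sum_x \sum_y (codegree e x y)%:R * (v x * (v y)^* ).
Proof.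
transitivity (\sum_t `|z * v t| ^+ 2).
  by rewrite mulr_sumr; apply: eq_bigr => t _; rewrite normrM exprMn.
under eq_bigr => t _.
  rewrite -eigen_v normCK rmorph_sum mulr_suml.
  under eq_bigr => x _.
    rewrite mulr_sumr.
    under eq_bigr => y _ do rewrite rmorphM rmorph_nat mulrACA mulrC.
    over.
  over.
rewrite exchange_big; apply: eq_bigr => x _ /=.
rewrite exchange_big; apply: eq_bigr => y _ /=.
by rewrite codegree_sum mulr_suml.
Qed.

(* Schur's test for the matrix with entries codegree e x y - 1. *)
Lemma eigenvalue_codegree_bound (K : C) :
    \sum_x v x = 0 -> (exists x, v x != 0) ->
    (forall x, \sum_y `|(codegree e x y)%:R - 1| <= K) ->
  `|z| ^+ 2 <= K.
Proof.
move=> sum_v0 [x0 vx0] rowK.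
pose w x y : C := (codegree e x y)%:R - 1.
pose N := \sum_x `|v x| ^+ 2.
have N_gt0 : 0 < N.
  rewrite /N (bigD1 x0) //= ltr_pwDl ?exprn_gt0 ?normr_gt0 //.
  by apply: sumr_ge0 => x _; rewrite exprn_ge0.
rewrite -(ler_pM2r N_gt0).
(* Replacing each codegree by [w] changes the double sum by the squared modulus of the total of [v],
   which is 0. *)
have zNE : `|z| ^+ 2 * N = \sum_x \sum_y w x y * (v x * (v y)^* ).
  rewrite eigenvector_codegree; apply/eqP; rewrite -subr_eq0 -sumrB.
  under eq_bigr => x _.
    rewrite -sumrB.
    under eq_bigr => y _ do rewrite -mulrBl subKr mul1r.
    rewrite -mulr_sumr -rmorph_sum sum_v0 rmorph0 mulr0; over.
  by rewrite big1.
have symE : \sum_x \sum_y `|w x y| * `|v y| ^+ 2 =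
            \sum_x \sum_y `|w x y| * `|v x| ^+ 2.
  rewrite exchange_big; apply: eq_bigr => x _; apply: eq_bigr => y _.
  by rewrite /w codegreeC.
rewrite -[leLHS]ger0_norm ?mulr_ge0 ?exprn_ge0 ?(ltW N_gt0) // zNE.
apply: (@le_trans _ _ (\sum_x \sum_y `|w x y| * `|v x| ^+ 2)); last first.
  rewrite /N mulr_sumr; apply: ler_sum => x _.
  by rewrite -mulr_suml; apply: ler_wpM2r; [rewrite exprn_ge0 | apply: rowK].
(* AM-GM on the product of the moduli of [v x] and [v y]; by [symE] the two halves have equal
   sums. *)
apply: (@le_trans _ _ (\sum_x \sum_y
    (`|w x y| * `|v x| ^+ 2 + `|w x y| * `|v y| ^+ 2) / 2)).
  apply: (le_trans (ler_norm_sum _ _ _)); apply: ler_sum => x _.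
  apply: (le_trans (ler_norm_sum _ _ _)); apply: ler_sum => y _.
  rewrite !normrM norm_conjC -mulrDr -mulrA ler_wpM2l //.
  by rewrite real_leif_mean_square ?normr_real.
under eq_bigr => x _ do rewrite -mulr_suml big_split /=.
by rewrite -mulr_suml big_split /= symE mulrDl -splitr.
Qed.

End Spectral.

Lemma digraph_lambda_le (R : realType) (V : finType) (e : rel V) (d K : nat)
    (l : R) :
    (forall x, #|[set y | e x y]| = d) ->
    (forall x, \sum_y `|(codegree e x y)%:R - 1| <= K%:R :> R[i]) ->
    0 <= l -> K%:R <= l ^+ 2 ->
  digraph_lambda R e d <= l.
Proof.
move=> deg_d rowK l_ge0 Kl; rewrite /digraph_lambda big_seq_cond.
(* The hypothesis [0 <= l] takes care of the default value of the maximum. *)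
apply: bigmax_le => // z /andP[z_eig zNd].
have normcE (x : R[i]) : `|x| = ((ComplexField.Normc.normc x)%:C)%C by case: x.
have {z_eig} : eigenvalue (adjacency_mx R e) z.
  rewrite eigenvalue_root_char; move: z_eig; rewrite /eigenvalues.
  case: closed_field_poly_normal => r /= ->.
  by rewrite (monicP (char_poly_monic _)) scale1r root_prod_XsubC.
case/eigenvalueP => u uA uN0.
(* The row eigenvector [u] is indexed by ordinals; [v] carries it back to the vertices. *)
pose v x := u 0 (enum_rank x).
have eigen_v y : \sum_x v x * (e x y)%:R = z * v y.
  have := congr1 (fun M : 'rV_#|V| => M 0 (enum_rank y)) uA.
  rewrite !mxE => <-; rewrite (reindex_onto enum_rank enum_val) /=.
    apply: eq_big => [x|x _]; first by rewrite enum_rankK eqxx.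
    by rewrite mxE !enum_rankK.
  by move=> i _; rewrite enum_valK.
have v_neq0 : exists x, v x != 0.
  by case/rV0Pn: uN0 => i ui; exists (enum_val i); rewrite /v enum_valK.
have sum_v0 : \sum_x v x = 0.
  apply: (eigenvector_sum0 _ deg_d) => //.
  (* The maximum leaves out every eigenvalue of modulus [d], in particular [d] itself. *)
  apply: contraNneq zNd => ->.
  apply/eqP/(@complexI R); rewrite -normcE normr_nat.
  by rewrite -(rmorph_nat (real_complex R)).
have := eigenvalue_codegree_bound eigen_v sum_v0 v_neq0 rowK.
rewrite normcE -(rmorph_nat (real_complex R)) -rmorphXn /= lecR => zK.
have normz_ge0 : 0 <= ComplexField.Normc.normc z.
  by case: z {uA eigen_v zK zNd} => a b; rewrite sqrtr_ge0.
by rewrite -(@ler_pXn2r _ 2) // (le_trans zK).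
Qed.

(** * Counting singular matrices *)

(** This is the union-type bound prod (1 - q^-i) >= 1 - n/q with denominators cleared: each factor
    costs at most q^-i <= 1/q. *)
Lemma leq_prod_expn_sub1 (q n : nat) : (0 < q)%N ->
  (q * q ^ (\sum_(1 <= i < n.+1) i) <=
   q * (\prod_(1 <= i < n.+1) (q ^ i - 1)) +
   n * q ^ (\sum_(1 <= i < n.+1) i))%N.
Proof.
move=> q_gt0; elim: n => [|n IHn].
  by rewrite !big_nil expn0 !muln1 leq_addr.
rewrite !(big_nat_recr n.+1) //=.
move: (\prod_(_ <= _ < _) _)%N (\sum_(_ <= _ < _) _)%N IHn => P s IHn.
rewrite expnD; set Q := (q ^ s)%N in IHn *.
have q_leq : (q <= q ^ n.+1)%N by rewrite -{1}(expn1 q) leq_pexp2l.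
(* Naming the predecessor [t] removes the truncated subtraction, leaving a polynomial inequality. *)
have [t qE] : exists t, (q ^ n.+1 = t.+1)%N by exists (q ^ n.+1).-1; lia.
rewrite qE in q_leq *; rewrite subn1 /=.
nia.
Qed.

(** The order of GL_n is q^C(n,2) prod (q^i - 1), and n^2 = C(n,2) + C(n+1,2), so the product bound
    leaves at most a fraction n/q of singular matrices. *)
Lemma card_singular_mx_leq (F : finFieldType) (n : nat) : (0 < n)%N ->
  (#|F| * #|[set A : 'M[F]_n | A \notin unitmx]| <= n * #|F| ^ (n ^ 2))%N.
Proof.
case: n => // n _; set q := #|F|.
have q_gt0 : (0 < q)%N by apply/card_gt0P; exists 0.
have unitE : #|[set A : 'M[F]_n.+1 | A \in unitmx]| = #|'GL_n.+1[F]%g|.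
  rewrite -[RHS](card_imset _ val_inj); apply: eq_card => A.
  rewrite inE; apply/idP/imsetP => [uA | [g _ ->]]; last exact: (valP g).
  by exists (FinRing.unit _ uA); rewrite ?inE.
have := cardsC [set A : 'M[F]_n.+1 | A \in unitmx].
rewrite card_mx -/q -[(_ * _)%N]/(n.+1 ^ 2)%N unitE card_GL // -/q.
have -> : ~: [set A : 'M[F]_n.+1 | A \in unitmx] =
          [set A | A \notin unitmx] by apply/setP => A; rewrite !inE.
set S := #|_| => cardE.
have := leq_prod_expn_sub1 n.+1 q_gt0.
have sumE : \sum_(1 <= i < n.+2) i = 'C(n.+2, 2) by rewrite -bin2_sum big_ltn.
have sqE : (n.+1 ^ 2 = 'C(n.+1, 2) + \sum_(1 <= i < n.+2) i)%N.
  rewrite sumE; elim: (n.+1) => // m IHm.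
  by rewrite (binS m.+1) bin1 {2}binS bin1; nia.
rewrite sqE expnD in cardE *.
nia.
Qed.

(** * The sum-product digraph *)

Section SumProduct.
Variables (F : finFieldType) (n : nat).
Notation edge := (@sum_product_edge F n).
Notation d := (#|F| ^ (n ^ 2))%N.

Let card_M : #|{: 'M[F]_n}| = d.
Proof. by rewrite card_mx mulnn. Qed.

Lemma card_sum_product_vertices :
  #|{: 'M[F]_n * 'M[F]_n}| = (#|F| ^ (2 * n ^ 2))%N.
Proof. by rewrite card_prod card_M -expnD addnn mul2n. Qed.

Lemma sum_product_outdeg u : #|[set v | edge u v]| = d.
Proof.
rewrite -card_M -cardsT -(@card_imset _ _ (fun B => (B, u.1 *m B - u.2))).
  apply: eq_card => -[B D]; rewrite inE /sum_product_edge /=.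
  apply/eqP/imsetP => [uBD | [B' _ [-> ->]]]; last by rewrite addrC subrK.
  by exists B; rewrite ?inE // uBD addrC addKr.
by move=> B B' [].
Qed.

Lemma sum_product_indeg v : #|[set u | edge u v]| = d.
Proof.
rewrite -card_M -cardsT -(@card_imset _ _ (fun A => (A, A *m v.1 - v.2))).
  apply: eq_card => -[A C]; rewrite inE /sum_product_edge /=.
  apply/eqP/imsetP => [ACv | [A' _ [-> ->]]]; last by rewrite subrK.
  by exists A; rewrite ?inE // ACv addrK.
by move=> A A' [].
Qed.

Lemma sum_product_codegree_unit u u' :
  u.1 - u'.1 \in unitmx -> codegree edge u u' = 1%N.
Proof.
move=> uU; pose B := invmx (u.1 - u'.1) *m (u.2 - u'.2).
rewrite -(cards1 (B, u.1 *m B - u.2)); apply: eq_card => -[X Y].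
rewrite !inE /sum_product_edge /= xpair_eqE.
have subE : (u.1 - u'.1) *m B = u.2 - u'.2 by rewrite mulKVmx.
apply/andP/andP => [[/eqP eX /eqP eX'] | [/eqP-> /eqP->]].
  have XB : X = B.
    by rewrite -[LHS](mulKmx uU) mulmxBl eX eX' opprD addrACA subrr addr0.
  by rewrite -XB eX addrC addKr !eqxx.
split; apply/eqP; first by rewrite addrC subrK.
by rewrite addrCA -opprB -subE mulmxBl subKr.
Qed.

(** Once [A] is fixed, each out-neighbour [t] of [u] is reached from (A, C) for exactly one [C], so
    the sum is the out-degree of [u]. *)
Lemma sum_product_codegree_fiber u A :
  (\sum_C codegree edge u (A, C) = d)%N.
Proof.
under eq_bigr => C _.
  rewrite /codegree -sum1_card big_mkcond /=.
  over.
rewrite exchange_big /= -(sum_product_outdeg u) -sum1_card [RHS]big_mkcond.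
apply: eq_bigr => t _; rewrite inE -big_mkcond /=.
under eq_bigl => C do rewrite inE.
case: (edge u t) => /=; last by rewrite big_pred0.
rewrite (big_pred1 (A *m t.1 - t.2)) // => C.
by rewrite /= [RHS]eq_sym subr_eq.
Qed.

Lemma sum_product_codegree_row (C : numDomainType) u :
  \sum_v `|(codegree edge u v)%:R - 1| <=
  (2 * d * #|[set A : 'M[F]_n | A \notin unitmx]|)%:R :> C.
Proof.
(* Where the difference is singular, the crude bound codegree + 1 sums to d + d over each fiber,
   giving the factor 2. *)
pose g v := (if (u.1 - v.1)%R \in unitmx then 0 else codegree edge u v + 1)%N.
apply: (@le_trans _ _ (\sum_v (g v)%:R)).
  apply: ler_sum => v _; rewrite /g; case: ifPn => [uU | _].
    by rewrite sum_product_codegree_unit // subrr normr0.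
  by rewrite natrD (le_trans (ler_normB _ _)) // normr1 normr_nat.
rewrite -natr_sum ler_nat.
have -> : (\sum_v g v = \sum_A \sum_D g (A, D))%N.
  by rewrite pair_bigA /=; apply: eq_bigr => -[].
rewrite -sum1_card big_distrr /= [leqRHS]big_mkcond.
rewrite [leqRHS](reindex_inj (@subrI _ u.1)) /=.
apply: leq_sum => A _; rewrite inE /g /=.
case: (u.1 - A \in unitmx) => /=; first by rewrite big1.
rewrite big_split /= sum_product_codegree_fiber sum1_card card_M.
by rewrite muln1 mul2n addnn.
Qed.

End SumProduct.

Unset Implicit Arguments.

Theorem theorem4p2 (R : realType) (n : nat) (hn : (0 < n)%N) :
  exists2 c : R, 0 < c &
    forall (q : nat) (F : finFieldType), #|F| = q -> odd q ->
      ndl_digraph (@sum_product_edge F n)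
        (q ^ (2 * n ^ 2))%N (q ^ (n ^ 2))%N
        (c * q%:R `^ ((n ^ 2)%:R - 2^-1)).
Proof.
(* The row bound is at most 2n d^2 / q, where d = q^(n^2). The square root of 2n would do as
   constant; 2n avoids the root since 2n <= (2n)^2. *)
exists (2 * n)%:R; first by rewrite ltr0n muln_gt0.
move=> q F <- _; split.
- exact: card_sum_product_vertices.
- exact: sum_product_outdeg.
- exact: sum_product_indeg.
have q_gt0 : (0 < #|F|)%N by apply/card_gt0P; exists 0.
have qR_gt0 : 0 < #|F|%:R :> R by rewrite ltr0n.
apply: (digraph_lambda_le (@sum_product_outdeg F n)
                          (@sum_product_codegree_row F n _)).
  by rewrite mulr_ge0 ?powR_ge0.
rewrite powRB ?(gt_eqF qR_gt0) ?implybT //.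
rewrite powR_mulrn ?powR12_sqrt ?(ltW qR_gt0) //.
rewrite exprMn expr_div_n sqr_sqrtr ?(ltW qR_gt0) // mulrA ler_pdivlMr //.
rewrite -!natrX -!natrM ler_nat.
have := card_singular_mx_leq F hn.
set s := #|[set _ | _]|; move: (#|F| ^ _)%N => d sd.
apply: (@leq_trans (2 * d * (n * d))); last by nia.
by rewrite -[leqLHS]mulnA leq_mul2l (mulnC s) sd orbT.
Qed.
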